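(* Let $0<c<b<a$ and let $P$ be a point of the ellipsoid $$\mathcal{E}=\left\{(x,y,z)\in\mathbb{R}^3:\ \frac{x^2}{a^2}+\frac{y^2}{b^2}+\frac{z^2}{c^2}=1\right\}.$$ Let $F_1=(-\sqrt{a^2-c^2},0,0)^T$ be the left focus of the focal hyperbola and $G_2=(\sqrt{a^2-b^2},0,0)^T$ the right focus of the focal ellipse of the confocal system determined by $\mathcal{E}$. Then the shortest length of the broken line $F_1HPEG_2$, where $H$ is a point of the focal hyperbola and $E$ is a point of the focal ellipse, that is, $$\min_{H}\bigl(|F_1H|+|HP|\bigr)+\min_{E}\bigl(|PE|+|EG_2|\bigr),$$ is equal to $2a+\sqrt{a^2-c^2}-\sqrt{a^2-b^2}$. Hence it is independent of the position of $P$ on the ellipsoid.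
   Context: For $0<c<b<a$, the focal ellipse of the confocal system of the ellipsoid $\frac{x^2}{a^2}+\frac{y^2}{b^2}+\frac{z^2}{c^2}=1$ is the curve $\left\{\frac{x^2}{a^2-c^2}+\frac{y^2}{b^2-c^2}=1,\ z=0\right\}$, and the focal hyperbola is the curve (with both branches) $\left\{\frac{x^2}{a^2-b^2}+\frac{z^2}{c^2-b^2}=1,\ y=0\right\}$. $|XY|$ denotes the Euclidean distance of the points $X,Y$. *)

(* Defs.v *)
From mathcomp Require Import all_boot all_order all_algebra.
From mathcomp Require Import all_classical all_reals.
Set Implicit Arguments.
Unset Strict Implicit.
Unset Printing Implicit Defensive.
Import Order.TTheory GRing.Theory Num.Theory.
Local Open Scope classical_set_scope.
Local Open Scope ring_scope.

Definition vec3 (R : realType) (x y z : R) : 'cV[R]_3 :=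
  \col_i [:: x; y; z]`_i.

Definition xcoord (R : realType) (X : 'cV[R]_3) : R := X (inord 0) 0.
Definition ycoord (R : realType) (X : 'cV[R]_3) : R := X (inord 1) 0.
Definition zcoord (R : realType) (X : 'cV[R]_3) : R := X (inord 2) 0.

(* Not the norm of X - Y: the library's norm on matrices is the sup norm. *)
Definition edist (R : realType) (X Y : 'cV[R]_3) : R :=
  Num.sqrt (\sum_i (X i 0 - Y i 0) ^+ 2).

Definition ellipsoid (R : realType) (a b c : R) : set 'cV[R]_3 :=
  [set X | xcoord X ^+ 2 / a ^+ 2 + ycoord X ^+ 2 / b ^+ 2
           + zcoord X ^+ 2 / c ^+ 2 = 1].

Definition focal_ellipse (R : realType) (a b c : R) : set 'cV[R]_3 :=
  [set X | xcoord X ^+ 2 / (a ^+ 2 - c ^+ 2)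
           + ycoord X ^+ 2 / (b ^+ 2 - c ^+ 2) = 1 /\ zcoord X = 0].

(* The denominator c ^+ 2 - b ^+ 2 is negative when 0 < c < b; no sign
   condition on x, so both branches are included. *)
Definition focal_hyperbola (R : realType) (a b c : R) : set 'cV[R]_3 :=
  [set X | xcoord X ^+ 2 / (a ^+ 2 - b ^+ 2)
           + zcoord X ^+ 2 / (c ^+ 2 - b ^+ 2) = 1 /\ ycoord X = 0].

Definition hyperbola_left_focus (R : realType) (a c : R) : 'cV[R]_3 :=
  vec3 (- Num.sqrt (a ^+ 2 - c ^+ 2)) 0 0.

Definition ellipse_right_focus (R : realType) (a b : R) : 'cV[R]_3 :=
  vec3 (Num.sqrt (a ^+ 2 - b ^+ 2)) 0 0.

(* An attained minimum, as opposed to [inf]. *)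
Definition is_min (R : realType) (A : set R) (m : R) : Prop :=
  A m /\ lbound A m.

Definition hyperbola_lengths (R : realType) (a b c : R) (P : 'cV[R]_3) : set R :=
  [set edist (hyperbola_left_focus a c) H + edist H P
    | H in focal_hyperbola a b c].

Definition ellipse_lengths (R : realType) (a b c : R) (P : 'cV[R]_3) : set R :=
  [set edist P E + edist E (ellipse_right_focus a b)
    | E in focal_ellipse a b c].

Definition broken_line_lengths (R : realType) (a b c : R) (P : 'cV[R]_3) :
    set R :=
  [set edist (hyperbola_left_focus a c) H + edist H P
       + edist P E + edist E (ellipse_right_focus a b)
    | H in focal_hyperbola a b c & E in focal_ellipse a b c].

(* Main.v *)
(* Write h^2 = a^2 - b^2, al^2 = a^2 - c^2, be^2 = b^2 - c^2 and
   P = (a u, b v, c w) with u^2 + v^2 + w^2 = 1, and let m, n be the elliptic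
   coordinates of (al u, be v) for the foci (-h, 0), (h, 0); these are, up to
   sign, the first semiaxes of the two hyperboloids of the confocal system
   through P. A point E = (al C, be S, 0) of the focal ellipse is at distance
   al - h C from G_2, and |PE|^2 - (a - m - n + h C)^2 is an affine function of
   (C, S) on the unit circle whose minimum is 0; hence
   min (|PE| + |E G_2|) = a + al - (m + n). Likewise, a point
   H = (-h X, 0, be Z) of the left branch of the focal hyperbola is at distance
   al X - h from F_1, and min (|F_1 H| + |HP|) = a - h + (m + n) follows from
   the reversed Cauchy-Schwarz inequality on X^2 - Z^2 = 1. In the sum of the
   two minima m + n cancels. *)
Require Import Defs.
From mathcomp Require Import all_boot all_order all_algebra.
From mathcomp Require Import all_classical all_reals.
From mathcomp Require Import ring lra.
Set Implicit Arguments.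
Unset Strict Implicit.

Import Order.TTheory GRing.Theory Num.Theory.
Local Open Scope classical_set_scope.
Local Open Scope ring_scope.

Lemma edist_vec3 (R : realType) (x y z x' y' z' : R) :
  edist (vec3 x y z) (vec3 x' y' z') =
  Num.sqrt ((x - x') ^+ 2 + (y - y') ^+ 2 + (z - z') ^+ 2).
Proof. by rewrite /edist !big_ord_recl big_ord0 !mxE /= addr0 addrA. Qed.

Lemma coord_vec3 (R : realType) (x y z : R) :
  (xcoord (vec3 x y z) = x) * (ycoord (vec3 x y z) = y) *
  (zcoord (vec3 x y z) = z).
Proof. by rewrite /xcoord /ycoord /zcoord !mxE !inordK. Qed.

Lemma vec3_coord (R : realType) (X : 'cV[R]_3) :
  X = vec3 (xcoord X) (ycoord X) (zcoord X).
Proof.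
apply/matrixP => i j; rewrite mxE ord1 /xcoord /ycoord /zcoord.
by case: i => [[|[|[|//]]] lti] /=; congr (X _ 0); apply/val_inj;
  rewrite /= inordK.
Qed.

Lemma is_minD (R : realType) (A B C : set R) (m n : R) :
  is_min A m -> is_min B n -> C = [set s + t | s in A & t in B] ->
  is_min C (m + n).
Proof.
move=> [Am lbm] [Bn lbn] ->; split; first by exists m => //; exists n.
by move=> _ [s As [t Bt <-]]; exact: lerD (lbm _ As) (lbn _ Bt).
Qed.

Lemma sqr_le_sqrtr (R : rcfType) (d D : R) : d ^+ 2 <= D -> d <= Num.sqrt D.
Proof. by move=> /ler_wsqrtr; rewrite sqrtr_sqr; exact/le_trans/ler_norm. Qed.

Lemma cauchy_schwarz_circle (R : realDomainType) (C S U V M : R) :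
  C ^+ 2 + S ^+ 2 = 1 -> U ^+ 2 + V ^+ 2 = M ^+ 2 -> 0 <= M ->
  U * C + V * S <= M.
Proof.
move=> CS UV M0; apply: (le_trans (ler_norm _)).
rewrite -(ger0_norm M0) -ler_sqr ?nnegrE // !real_normK ?num_real // -UV.
rewrite -subr_ge0 (_ : _ - _ = (U * S - V * C) ^+ 2) ?sqr_ge0 //.
have C2 : C ^+ 2 = 1 - S ^+ 2 by lra.
by ring: C2.
Qed.

Lemma cauchy_schwarz_hyperbola (R : realDomainType) (X Z U V W : R) :
  X ^+ 2 - Z ^+ 2 = 1 -> U ^+ 2 - V ^+ 2 = W ^+ 2 -> 0 <= X -> 0 <= U ->
  W <= U * X - V * Z.
Proof.
move=> XZ UV X0 U0.
have VU : `|V| <= U.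
  rewrite -(ger0_norm U0) -ler_sqr ?nnegrE // !real_normK ?num_real //.
  by rewrite -subr_ge0 UV sqr_ge0.
have ZX : `|Z| <= X.
  rewrite -(ger0_norm X0) -ler_sqr ?nnegrE // !real_normK ?num_real //.
  by rewrite -subr_ge0 XZ.
have T0 : 0 <= U * X - V * Z.
  rewrite subr_ge0 (le_trans (ler_norm _)) // normrM ler_pM //.
apply: (le_trans (ler_norm _)).
rewrite -(ger0_norm T0) -ler_sqr ?nnegrE // !real_normK ?num_real // -UV.
rewrite -subr_ge0 (_ : _ - _ = (U * Z - V * X) ^+ 2) ?sqr_ge0 //.
have X2 : X ^+ 2 = 1 + Z ^+ 2 by lra.
by ring: X2.
Qed.

(* [m] and [n] are the elliptic coordinates of the point [(al * u, be * v)] of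
   the plane with respect to the foci [(h, 0)] and [(-h, 0)]: half the sum and
   half the (signed) difference of its distances to them. *)
Lemma elliptic_coordinates (R : rcfType) (h al be u v : R) :
  0 < h -> 0 < al -> 0 < be -> al ^+ 2 = h ^+ 2 + be ^+ 2 ->
  u ^+ 2 + v ^+ 2 <= 1 ->
  exists m n : R,
    [/\ h <= m <= al, - h <= n <= h, m * n = h * al * u &
      m ^+ 2 + n ^+ 2 = h ^+ 2 + (al * u) ^+ 2 + (be * v) ^+ 2].
Proof.
move=> h0 al0 be0 al2 uv.
pose s := Num.sqrt ((al * u + h) ^+ 2 + (be * v) ^+ 2).
pose r := Num.sqrt ((al * u - h) ^+ 2 + (be * v) ^+ 2).
have s0 : 0 <= s := sqrtr_ge0 _.
have r0 : 0 <= r := sqrtr_ge0 _.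
have s2 : s ^+ 2 = (al * u + h) ^+ 2 + (be * v) ^+ 2.
  by rewrite sqr_sqrtr // addr_ge0 ?sqr_ge0.
have r2 : r ^+ 2 = (al * u - h) ^+ 2 + (be * v) ^+ 2.
  by rewrite sqr_sqrtr // addr_ge0 ?sqr_ge0.
pose m := (s + r) / 2; pose n := (s - r) / 2.
have mn : m * n = h * al * u by rewrite /m /n; field: s2 r2.
have m2n2 : m ^+ 2 + n ^+ 2 = h ^+ 2 + (al * u) ^+ 2 + (be * v) ^+ 2.
  by rewrite /m /n; field: s2 r2.
have m0 : 0 <= m by rewrite /m; lra.
have [nm nm'] : n <= m /\ - n <= m by rewrite /m /n; lra.
have nm2 : n ^+ 2 <= m ^+ 2 by nra.
have mn2 : m ^+ 2 * n ^+ 2 = h ^+ 2 * al ^+ 2 * u ^+ 2.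
  by rewrite -exprMn mn; ring.
have qh : (m ^+ 2 - h ^+ 2) * (h ^+ 2 - n ^+ 2) = (h * be * v) ^+ 2.
  transitivity (h ^+ 2 * (m ^+ 2 + n ^+ 2) - h ^+ 4 - m ^+ 2 * n ^+ 2).
    by ring.
  by rewrite m2n2 mn2; ring.
have qal : (al ^+ 2 - m ^+ 2) * (al ^+ 2 - n ^+ 2) =
    (al * be) ^+ 2 * (1 - (u ^+ 2 + v ^+ 2)).
  transitivity (al ^+ 4 - al ^+ 2 * (m ^+ 2 + n ^+ 2) + m ^+ 2 * n ^+ 2).
    by ring.
  by rewrite m2n2 mn2; ring: al2.
have qh0 : 0 <= (m ^+ 2 - h ^+ 2) * (h ^+ 2 - n ^+ 2) by rewrite qh sqr_ge0.
have qal0 : 0 <= (al ^+ 2 - m ^+ 2) * (al ^+ 2 - n ^+ 2).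
  by rewrite qal mulr_ge0 ?sqr_ge0 // subr_ge0.
have be20 : 0 < be ^+ 2 by rewrite exprn_gt0.
have hm2 : h ^+ 2 <= m ^+ 2 by nra.
have hn2 : n ^+ 2 <= h ^+ 2 by nra.
have alm2 : m ^+ 2 <= al ^+ 2 by nra.
exists m, n; split => //; [|by nra].
rewrite -ler_sqr ?nnegrE ?(ltW h0) // hm2.
by rewrite -ler_sqr ?nnegrE ?(ltW al0).
Qed.

Section Minima.
Variables (R : realType) (a b c h al be u v w m n : R).
Hypotheses (h_gt0 : 0 < h) (al_gt0 : 0 < al) (be_gt0 : 0 < be) (a_gt0 : 0 < a).
Hypotheses (a2 : a ^+ 2 = c ^+ 2 + al ^+ 2) (b2 : b ^+ 2 = c ^+ 2 + be ^+ 2).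
Hypothesis al2 : al ^+ 2 = h ^+ 2 + be ^+ 2.
Hypothesis uvw : u ^+ 2 + v ^+ 2 + w ^+ 2 = 1.
Hypothesis mnu : m * n = h * al * u.
Hypothesis m2n2 : m ^+ 2 + n ^+ 2 = h ^+ 2 + (al * u) ^+ 2 + (be * v) ^+ 2.
Hypotheses (m_itv : h <= m <= al) (n_itv : - h <= n <= h).

Let M := a * (m + n) - h ^+ 2 - m * n.
Let U := a * u * al + (a - (m + n)) * h.
Let V := b * v * be.

Lemma le_semiaxes : h <= al <= a.
Proof.
apply/andP; split.
  by rewrite -ler_sqr ?nnegrE ?(ltW h_gt0) ?(ltW al_gt0) // al2 lerDl sqr_ge0.
by rewrite -ler_sqr ?nnegrE ?(ltW al_gt0) ?(ltW a_gt0) // a2 lerDr sqr_ge0.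
Qed.

Let mn2 : m ^+ 2 * n ^+ 2 = h ^+ 2 * al ^+ 2 * u ^+ 2.
Proof. by rewrite -exprMn mnu; ring. Qed.

Let hU : h * U = a * (m * n) + (a - (m + n)) * h ^+ 2.
Proof. by rewrite mnu /U; ring. Qed.

Let qh : (m ^+ 2 - h ^+ 2) * (h ^+ 2 - n ^+ 2) = (h * be * v) ^+ 2.
Proof.
transitivity (h ^+ 2 * (m ^+ 2 + n ^+ 2) - h ^+ 4 - m ^+ 2 * n ^+ 2).
  by ring.
by rewrite m2n2 mn2; ring.
Qed.

Let qal : (al ^+ 2 - m ^+ 2) * (al ^+ 2 - n ^+ 2) = (al * be * w) ^+ 2.
Proof.
transitivity (al ^+ 4 - al ^+ 2 * (m ^+ 2 + n ^+ 2) + m ^+ 2 * n ^+ 2).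
  by ring.
have w2 : w ^+ 2 = 1 - u ^+ 2 - v ^+ 2 by rewrite -uvw; ring.
by rewrite m2n2 mn2; ring: al2 w2.
Qed.

Let M_ge0 : 0 <= M.
Proof.
have := (h_gt0, le_semiaxes, m_itv, n_itv).
move=> [[[? /andP[? ?]] /andP[? ?]] /andP[? ?]].
rewrite -(pmulr_rge0 _ (mulr_gt0 (@ltr0n R 2) h_gt0)).
rewrite (_ : _ * M = (h + n) * ((a - h) * (m + h))
                     + (h - n) * ((a + h) * (m - h))); last by rewrite /M; ring.
by rewrite addr_ge0 // !mulr_ge0 //; lra.
Qed.

(* With [e1], [e2], [e3] the elementary symmetric functions of [a, -m, -n],
   [h^2 (M^2 - U^2)] is [(h^3 + e2 h)^2 - (e1 h^2 + e3)^2], the product of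
   [(h + a)(h - m)(h - n)] and [(h - a)(h + m)(h + n)]. *)
Let UVM : U ^+ 2 + V ^+ 2 = M ^+ 2.
Proof.
have h2 : h ^+ 2 != 0 by rewrite sqrf_eq0 gt_eqF.
apply: (mulfI h2); rewrite mulrDr -exprMn hU.
have -> : h ^+ 2 * V ^+ 2 =
    (a ^+ 2 - h ^+ 2) * ((m ^+ 2 - h ^+ 2) * (h ^+ 2 - n ^+ 2)).
  by rewrite qh /V; ring: b2 a2 al2.
by rewrite /M; ring.
Qed.

Let ellipse_sqr_dist (C S : R) : C ^+ 2 + S ^+ 2 = 1 ->
  (a * u - al * C) ^+ 2 + (b * v - be * S) ^+ 2 + (c * w - 0) ^+ 2 =
  (a - (m + n) + h * C) ^+ 2 + 2 * (M - (U * C + V * S)).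
Proof.
move=> CS.
have w2 : w ^+ 2 = 1 - u ^+ 2 - v ^+ 2 by rewrite -uvw; ring.
have C2 : C ^+ 2 = 1 - S ^+ 2 by lra.
have m2 : m ^+ 2 = h ^+ 2 + (al * u) ^+ 2 + (be * v) ^+ 2 - n ^+ 2.
  by rewrite -m2n2 addrK.
by rewrite /M /U /V; ring: w2 a2 b2 al2 C2 m2.
Qed.

Lemma ellipse_dist_ge (C S : R) : C ^+ 2 + S ^+ 2 = 1 ->
  a - (m + n) + h * C <=
  edist (vec3 (a * u) (b * v) (c * w)) (vec3 (al * C) (be * S) 0).
Proof.
move=> CS; rewrite edist_vec3; apply: sqr_le_sqrtr.
rewrite ellipse_sqr_dist // lerDl mulr_ge0 // subr_ge0.
exact: cauchy_schwarz_circle.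
Qed.

Lemma ellipse_dist_attained : exists C S : R, C ^+ 2 + S ^+ 2 = 1 /\
  edist (vec3 (a * u) (b * v) (c * w)) (vec3 (al * C) (be * S) 0) =
  a - (m + n) + h * C.
Proof.
have := (h_gt0, le_semiaxes, m_itv, n_itv).
move=> [[[? /andP[? ?]] /andP[? ?]] /andP[? ?]].
have [M0|Mn0] := eqVneq M 0.
  have [U0 V0] : U = 0 /\ V = 0.
    have := UVM; move=> /eqP; rewrite M0 expr0n paddr_eq0 ?sqr_ge0 //.
    by rewrite !sqrf_eq0 => /andP[/eqP-> /eqP->].
  exists 1, 0; have CS : 1 ^+ 2 + 0 ^+ 2 = 1 :> R by ring.
  split=> //; rewrite edist_vec3 ellipse_sqr_dist // U0 V0 M0 !mul0r addr0.
  rewrite subr0 mulr0 addr0 sqrtr_sqr ger0_norm //; lra.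
have M_gt0 : 0 < M by rewrite lt_def Mn0.
exists (U / M), (V / M); have CS : (U / M) ^+ 2 + (V / M) ^+ 2 = 1.
  by rewrite !expr_div_n -mulrDl UVM divff // sqrf_eq0.
split=> //; rewrite edist_vec3 ellipse_sqr_dist //.
have -> : U * (U / M) + V * (V / M) = M.
  by rewrite (mulrA U) (mulrA V) -mulrDl -!expr2 UVM expr2 mulfK.
rewrite subrr mulr0 addr0 sqrtr_sqr ger0_norm //.
rewrite -(pmulr_rge0 _ M_gt0) mulrDr mulrCA (mulrC M (_ / _)) divfK // hU.
rewrite [leRHS](_ : _ = (a - m) * (a - n) * (m + n)); last by rewrite /M; ring.
by rewrite !mulr_ge0 //; lra.
Qed.

Lemma ellipse_focus_dist (C S : R) : C ^+ 2 + S ^+ 2 = 1 ->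
  edist (vec3 (al * C) (be * S) 0) (vec3 h 0 0) = al - h * C.
Proof.
move=> CS; rewrite edist_vec3.
have C2 : C ^+ 2 = 1 - S ^+ 2 by lra.
have -> : (al * C - h) ^+ 2 + (be * S - 0) ^+ 2 + (0 - 0) ^+ 2 =
    (al - h * C) ^+ 2 by ring: al2 C2.
have ? := h_gt0; have /andP[? _] := le_semiaxes.
rewrite sqrtr_sqr ger0_norm //; have C1 : C <= 1 by nra.
by nra.
Qed.

Lemma ellipse_lengths_min : h = Num.sqrt (a ^+ 2 - b ^+ 2) ->
  is_min (ellipse_lengths a b c (vec3 (a * u) (b * v) (c * w)))
    (a + al - (m + n)).
Proof.
move=> hE; rewrite /ellipse_lengths /ellipse_right_focus -hE.
have acE : a ^+ 2 - c ^+ 2 = al ^+ 2 by rewrite a2; ring.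
have bcE : b ^+ 2 - c ^+ 2 = be ^+ 2 by rewrite b2; ring.
have aln0 : al != 0 by rewrite gt_eqF.
have ben0 : be != 0 by rewrite gt_eqF.
split.
  have [C [S [CS dE]]] := ellipse_dist_attained.
  exists (vec3 (al * C) (be * S) 0).
    rewrite /focal_ellipse /= !coord_vec3 acE bcE; split=> //.
    have C2 : C ^+ 2 = 1 - S ^+ 2 by lra.
    by field: C2; rewrite aln0 ben0.
  by rewrite dE ellipse_focus_dist //; ring.
move=> _ [E + <-]; rewrite (vec3_coord E).
set x := xcoord E; set y := ycoord E; set z := zcoord E.
rewrite /focal_ellipse /= !coord_vec3 acE bcE => -[xy ->].
have CS : (x / al) ^+ 2 + (y / be) ^+ 2 = 1 by rewrite !expr_div_n.
have -> : x = al * (x / al) by rewrite mulrC divfK.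
have -> : y = be * (y / be) by rewrite mulrC divfK.
rewrite ellipse_focus_dist //; have := ellipse_dist_ge CS; lra.
Qed.

Let W := al ^+ 2 + m * n + a * (m + n).
Let U' := a * u * h + (a + (m + n)) * al.
Let V' := c * w * be.

Let alU' : al * U' = a * (m * n) + (a + (m + n)) * al ^+ 2.
Proof. by rewrite mnu /U'; ring. Qed.

Let U'V'W : U' ^+ 2 - V' ^+ 2 = W ^+ 2.
Proof.
have h2 : al ^+ 2 != 0 by rewrite sqrf_eq0 gt_eqF.
apply: (mulfI h2); rewrite mulrBr -exprMn alU'.
have -> : al ^+ 2 * V' ^+ 2 =
    (a ^+ 2 - al ^+ 2) * ((al ^+ 2 - m ^+ 2) * (al ^+ 2 - n ^+ 2)).
  by rewrite qal /V'; ring: a2.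
by rewrite /W; ring.
Qed.

Let W_gt0 : 0 < W.
Proof.
have := (h_gt0, le_semiaxes, m_itv, n_itv).
move=> [[[? /andP[? ?]] /andP[? ?]] /andP[? ?]].
have ? : h < al by rewrite -ltr_sqr ?nnegrE ?ltW // al2 ltrDl exprn_gt0.
have ? : 0 <= m * (n + h) by rewrite mulr_ge0; lra.
have ? : 0 <= (al - m) * h by rewrite mulr_ge0; lra.
have ? : 0 < al * (al - h) by rewrite mulr_gt0; lra.
have ? : 0 <= a * (m + n) by rewrite mulr_ge0; lra.
by rewrite /W; lra.
Qed.

Let U'_ge0 : 0 <= U'.
Proof.
have := (h_gt0, le_semiaxes, m_itv, n_itv).
move=> [[[? /andP[? ?]] /andP[? ?]] /andP[? ?]].
rewrite -(pmulr_rge0 _ al_gt0) alU'.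
have ? : 0 <= m * (n + h) by rewrite mulr_ge0; lra.
have ? : 0 <= (al - m) * h by rewrite mulr_ge0; lra.
have ? : 0 <= al * (al - h) by rewrite mulr_ge0; lra.
have ? : 0 <= al ^+ 2 + m * n by lra.
rewrite (_ : _ + _ = a * (al ^+ 2 + m * n) + (m + n) * al ^+ 2); last by ring.
by rewrite addr_ge0 // mulr_ge0 ?sqr_ge0; lra.
Qed.

Let hyperbola_sqr_dist (X Z : R) : X ^+ 2 - Z ^+ 2 = 1 ->
  (- (h * X) - a * u) ^+ 2 + (0 - b * v) ^+ 2 + (be * Z - c * w) ^+ 2 =
  (a + (m + n) - al * X) ^+ 2 + 2 * (U' * X - V' * Z - W).
Proof.
move=> XZ.
have w2 : w ^+ 2 = 1 - u ^+ 2 - v ^+ 2 by rewrite -uvw; ring.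
have X2 : X ^+ 2 = 1 + Z ^+ 2 by lra.
have m2 : m ^+ 2 = h ^+ 2 + (al * u) ^+ 2 + (be * v) ^+ 2 - n ^+ 2.
  by rewrite -m2n2 addrK.
by rewrite /W /U' /V'; ring: w2 a2 b2 al2 X2 m2.
Qed.

Lemma hyperbola_dist_ge (X Z : R) : X ^+ 2 - Z ^+ 2 = 1 -> 0 <= X ->
  a + (m + n) - al * X <=
  edist (vec3 (- (h * X)) 0 (be * Z)) (vec3 (a * u) (b * v) (c * w)).
Proof.
move=> XZ X0; rewrite edist_vec3; apply: sqr_le_sqrtr.
rewrite hyperbola_sqr_dist // lerDl mulr_ge0 // subr_ge0.
exact: cauchy_schwarz_hyperbola.
Qed.

Lemma hyperbola_dist_attained : exists X Z : R, [/\ X ^+ 2 - Z ^+ 2 = 1,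
  0 <= X &
  edist (vec3 (- (h * X)) 0 (be * Z)) (vec3 (a * u) (b * v) (c * w)) =
  a + (m + n) - al * X].
Proof.
have := (h_gt0, le_semiaxes, m_itv, n_itv).
move=> [[[? /andP[? ?]] /andP[? ?]] /andP[? ?]].
have Wn0 : W != 0 by rewrite gt_eqF.
exists (U' / W), (V' / W); have XZ : (U' / W) ^+ 2 - (V' / W) ^+ 2 = 1.
  by rewrite !expr_div_n -mulrBl U'V'W divff // sqrf_eq0.
split=> //; first by rewrite divr_ge0 // ltW.
rewrite edist_vec3 hyperbola_sqr_dist //.
have -> : U' * (U' / W) - V' * (V' / W) = W.
  by rewrite (mulrA U') (mulrA V') -mulrBl -!expr2 U'V'W expr2 mulfK.
rewrite subrr mulr0 addr0 sqrtr_sqr ger0_norm //.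
rewrite -(pmulr_rge0 _ W_gt0) mulrBr mulrCA (mulrC W (_ / _)) divfK // alU'.
rewrite [leRHS](_ : _ = (a + m) * (a + n) * (m + n)); last by rewrite /W; ring.
by rewrite !mulr_ge0 //; lra.
Qed.

Lemma hyperbola_focus_dist (X Z : R) : X ^+ 2 - Z ^+ 2 = 1 -> 0 <= X ->
  edist (vec3 (- al) 0 0) (vec3 (- (h * X)) 0 (be * Z)) = al * X - h /\
  edist (vec3 (- al) 0 0) (vec3 (h * X) 0 (be * Z)) = al * X + h.
Proof.
move=> XZ X0; have X2 : X ^+ 2 = 1 + Z ^+ 2 by lra.
have X1 : 1 <= X by nra.
have ? := h_gt0; have /andP[? _] := le_semiaxes.
rewrite !edist_vec3; split.
  have -> : (- al - - (h * X)) ^+ 2 + (0 - 0) ^+ 2 + (0 - be * Z) ^+ 2 =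
      (al * X - h) ^+ 2 by ring: al2 X2.
  by rewrite sqrtr_sqr ger0_norm //; nra.
have -> : (- al - h * X) ^+ 2 + (0 - 0) ^+ 2 + (0 - be * Z) ^+ 2 =
    (al * X + h) ^+ 2 by ring: al2 X2.
by rewrite sqrtr_sqr ger0_norm //; nra.
Qed.

End Minima.

(* Reflecting [P] in the plane [x = 0] changes the signs of [u] and [n], so the
   bound on the left branch also gives one on the right branch. *)
Lemma hyperbola_lengths_min (R : realType) (a b c h al be u v w m n : R) :
  0 < h -> 0 < al -> 0 < be -> 0 < a ->
  a ^+ 2 = c ^+ 2 + al ^+ 2 -> b ^+ 2 = c ^+ 2 + be ^+ 2 ->
  al ^+ 2 = h ^+ 2 + be ^+ 2 -> u ^+ 2 + v ^+ 2 + w ^+ 2 = 1 ->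
  m * n = h * al * u ->
  m ^+ 2 + n ^+ 2 = h ^+ 2 + (al * u) ^+ 2 + (be * v) ^+ 2 ->
  h <= m <= al -> - h <= n <= h -> al = Num.sqrt (a ^+ 2 - c ^+ 2) ->
  is_min (hyperbola_lengths a b c (vec3 (a * u) (b * v) (c * w)))
    (a - h + (m + n)).
Proof.
move=> h0 al0 be0 a0 a2 b2 al2 uvw mnu m2n2 mI nI alE.
rewrite /hyperbola_lengths /hyperbola_left_focus -alE.
have abE : a ^+ 2 - b ^+ 2 = h ^+ 2 by lra.
have cbE : c ^+ 2 - b ^+ 2 = - be ^+ 2 by lra.
have hn0 : h != 0 by rewrite gt_eqF.
have ben0 : be != 0 by rewrite gt_eqF.
split.
  have [X [Z [XZ X0 dE]]] :=
    hyperbola_dist_attained h0 al0 be0 a0 a2 b2 al2 uvw mnu m2n2 mI nI.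
  exists (vec3 (- (h * X)) 0 (be * Z)).
    rewrite /focal_hyperbola /= !coord_vec3 abE cbE; split=> //.
    have X2 : X ^+ 2 = 1 + Z ^+ 2 by lra.
    by field: X2; rewrite hn0 ben0.
  by rewrite dE (hyperbola_focus_dist h0 al0 a0 a2 al2 XZ X0).1; ring.
move=> _ [H + <-]; rewrite (vec3_coord H).
set x := xcoord H; set y := ycoord H; set z := zcoord H.
rewrite /focal_hyperbola /= !coord_vec3 abE cbE => -[xz ->].
have -> : z = be * (z / be) by rewrite mulrC divfK.
have [x0|x0] := leP x 0.
  have XZ : (- x / h) ^+ 2 - (z / be) ^+ 2 = 1.
    by rewrite -xz !expr_div_n sqrrN invrN mulrN.
  have X0 : 0 <= - x / h by rewrite divr_ge0 ?oppr_ge0 // ltW.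
  have -> : x = - (h * (- x / h)) by rewrite mulrC divfK // opprK.
  rewrite (hyperbola_focus_dist h0 al0 a0 a2 al2 XZ X0).1.
  have := hyperbola_dist_ge h0 al0 a0 a2 b2 al2 uvw mnu m2n2 mI nI XZ X0.
  lra.
have XZ : (x / h) ^+ 2 - (z / be) ^+ 2 = 1.
  by rewrite -xz !expr_div_n invrN mulrN.
have X0 : 0 <= x / h by rewrite divr_ge0 // ltW.
have -> : x = h * (x / h) by rewrite mulrC divfK.
rewrite (hyperbola_focus_dist h0 al0 a0 a2 al2 XZ X0).2.
have uvw' : (- u) ^+ 2 + v ^+ 2 + w ^+ 2 = 1 by rewrite sqrrN.
have mnu' : m * - n = h * al * - u by rewrite !mulrN mnu.
have m2n2' : m ^+ 2 + (- n) ^+ 2 =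
    h ^+ 2 + (al * - u) ^+ 2 + (be * v) ^+ 2 by rewrite mulrN !sqrrN.
have nI' : - h <= - n <= h by move: nI => /andP[? ?]; lra.
have := hyperbola_dist_ge h0 al0 a0 a2 b2 al2 uvw' mnu' m2n2' mI nI' XZ X0.
rewrite !edist_vec3 mulrN -opprD sqrrN.
rewrite -(sqrrN (h * _ - _)) opprB.
by move: nI => /andP[? ?]; lra.
Qed.

Unset Implicit Arguments.

Theorem theorem4 (R : realType) (a b c : R)
    (c_gt0 : 0 < c) (c_lt_b : c < b) (b_lt_a : b < a) :
  (forall P : 'cV[R]_3, ellipsoid a b c P ->
     is_min (broken_line_lengths a b c P)
       (2 * a + Num.sqrt (a ^+ 2 - c ^+ 2) - Num.sqrt (a ^+ 2 - b ^+ 2)) /\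
     exists mH mE : R,
       [/\ is_min (hyperbola_lengths a b c P) mH,
           is_min (ellipse_lengths a b c P) mE &
           mH + mE = 2 * a + Num.sqrt (a ^+ 2 - c ^+ 2)
                     - Num.sqrt (a ^+ 2 - b ^+ 2)]) /\
  (exists L : R, forall P : 'cV[R]_3, ellipsoid a b c P ->
     is_min (broken_line_lengths a b c P) L).
Proof.
suff min4 P : ellipsoid a b c P -> exists mH mE : R,
    [/\ is_min (hyperbola_lengths a b c P) mH,
        is_min (ellipse_lengths a b c P) mE &
        mH + mE = 2 * a + Num.sqrt (a ^+ 2 - c ^+ 2)
                  - Num.sqrt (a ^+ 2 - b ^+ 2)].
  have minL P : ellipsoid a b c P -> is_min (broken_line_lengths a b c P)
      (2 * a + Num.sqrt (a ^+ 2 - c ^+ 2) - Num.sqrt (a ^+ 2 - b ^+ 2)).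
    move=> /min4[mH [mE [mHP mEP <-]]]; apply: is_minD mHP mEP _.
    rewrite /broken_line_lengths /hyperbola_lengths /ellipse_lengths.
    apply/seteqP; split=> [_ [H HH [E EE <-]]|_ [_ [H HH <-] [_ [E EE <-] <-]]].
      exists (edist (hyperbola_left_focus a c) H + edist H P); first by exists H.
      exists (edist P E + edist E (ellipse_right_focus a b)); first by exists E.
      by rewrite addrA.
    by exists H => //; exists E => //; rewrite addrA.
  split=> [P PE|]; first by split; [exact: minL|exact: min4].
  by exists (2 * a + Num.sqrt (a ^+ 2 - c ^+ 2) - Num.sqrt (a ^+ 2 - b ^+ 2)).
have [b0 a0] : 0 < b /\ 0 < a by lra.
have sqrB_gt0 (x y : R) : 0 < y -> y < x -> 0 < x ^+ 2 - y ^+ 2.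
  by move=> y0 yx; rewrite subr_gt0 ltr_sqr ?nnegrE; lra.
have ab := sqrB_gt0 _ _ b0 b_lt_a.
have bc := sqrB_gt0 _ _ c_gt0 c_lt_b.
have ac := sqrB_gt0 _ _ c_gt0 (lt_trans c_lt_b b_lt_a).
set h := Num.sqrt (a ^+ 2 - b ^+ 2); set al := Num.sqrt (a ^+ 2 - c ^+ 2).
pose be := Num.sqrt (b ^+ 2 - c ^+ 2).
have h2 : h ^+ 2 = a ^+ 2 - b ^+ 2 by rewrite sqr_sqrtr ?ltW.
have alac : al ^+ 2 = a ^+ 2 - c ^+ 2 by rewrite sqr_sqrtr ?ltW.
have be2 : be ^+ 2 = b ^+ 2 - c ^+ 2 by rewrite sqr_sqrtr ?ltW.
have [h0 al0 be0] : [/\ 0 < h, 0 < al & 0 < be] by rewrite !sqrtr_gt0.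
have [a2 b2 al2] : [/\ a ^+ 2 = c ^+ 2 + al ^+ 2, b ^+ 2 = c ^+ 2 + be ^+ 2 &
    al ^+ 2 = h ^+ 2 + be ^+ 2] by rewrite h2 alac be2; split; ring.
rewrite (vec3_coord P) /ellipsoid /= !coord_vec3 -!expr_div_n.
set u := xcoord P / a; set v := ycoord P / b; set w := zcoord P / c => uvw.
have -> : xcoord P = a * u by rewrite mulrC divfK ?gt_eqF.
have -> : ycoord P = b * v by rewrite mulrC divfK ?gt_eqF.
have -> : zcoord P = c * w by rewrite mulrC divfK ?gt_eqF.
have uv : u ^+ 2 + v ^+ 2 <= 1 by rewrite -uvw lerDl sqr_ge0.
have [m [n [mI nI mnu m2n2]]] := elliptic_coordinates h0 al0 be0 al2 uv.
exists (a - h + (m + n)), (a + al - (m + n)); split; last by ring.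
  by apply: (@hyperbola_lengths_min _ _ _ _ _ al be).
by apply: (@ellipse_lengths_min _ _ _ _ h al be).
Qed.
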